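(* Let $p,q\in\mathbb{C}$. The zero equilibrium $\bar w=0$ of the difference equation $w_{n+1}=\dfrac{w_n}{1+pw_n+qw_{n-1}}$, $n=0,1,\ldots$, is non-hyperbolic.
   Context: For a second order difference equation $w_{n+1}=f(w_n,w_{n-1})$ over $\mathbb{C}$, with $f=f(u_0,u_1)$, an equilibrium is a point $\bar w$ with $f(\bar w,\bar w)=\bar w$. The characteristic equation at $\bar w$ is $\lambda^2-a_0\lambda-a_1=0$, where $a_i=\frac{\partial f}{\partial u_i}(\bar w,\bar w)$ for $i=0,1$. The equilibrium is non-hyperbolic if at least one root of the characteristic equation has modulus $1$. *)

(* Defs.v *)
From Stdlib Require Import Reals.
From Coquelicot Require Import Coquelicot.

Open Scope C_scope.

(* A map [f : C -> C -> C] stands for the second order difference equation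
   w_{n+1} = f w_n w_{n-1}: its first argument is u_0, the second is u_1. *)

Definition is_equilibrium (f : C -> C -> C) (w : C) : Prop := f w w = w.

(* Complex partial derivatives at the point (u0, u1): [is_derive] over the
   scalar ring [C_AbsRing] is complex differentiability. *)
Definition is_partial_0 (f : C -> C -> C) (u0 u1 a : C) : Prop :=
  is_derive (K := C_AbsRing) (V := C_NormedModule) (fun z : C => f z u1) u0 a.

Definition is_partial_1 (f : C -> C -> C) (u0 u1 a : C) : Prop :=
  is_derive (K := C_AbsRing) (V := C_NormedModule) (fun z : C => f u0 z) u1 a.

Definition is_characteristic_root (a0 a1 lambda : C) : Prop :=
  Cpow lambda 2 - a0 * lambda - a1 = 0.

(* [a0] and [a1] are unique when they exist, so the existential only names the
   coefficients of the characteristic equation, and asserts that it is defined. *)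
Definition non_hyperbolic (f : C -> C -> C) (w : C) : Prop :=
  exists a0 a1 : C,
    is_partial_0 f w w a0 /\
    is_partial_1 f w w a1 /\
    exists lambda : C, is_characteristic_root a0 a1 lambda /\ Cmod lambda = 1%R.

(* Division in [C] is total; the denominator is 1 at (0, 0), hence nonzero in a
   neighbourhood of (0, 0), so the convention for division by zero plays no role
   in the equilibrium equation or the partial derivatives at 0. *)
Definition rational_map (p q u0 u1 : C) : C := u0 / (1 + p * u0 + q * u1).

(* Main.v *)
Require Import Defs.
From Stdlib Require Import Reals Lra.
From Coquelicot Require Import Coquelicot.

Local Open Scope C_scope.

(** Along the axis [u1 = 0] the map is [z / (1 + p z) = z + O(z^2)], and along
    the axis [u0 = 0] it vanishes identically.  Hence the partial derivatives at
    the origin are [1] and [0] whatever [p] and [q] are, the characteristic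
    equation is [lambda^2 - lambda = 0], and its root [1] lies on the unit
    circle.  The only analytic point is the first derivative, which is
    [is_derive_mobius_0]: it rests on the explicit remainder
    [z / (1 + c z) - z = - c z^2 / (1 + c z)], whose denominator stays away
    from zero near the origin. *)

(** Triangle inequality for [1 = (1 + w) + (- w)]; it keeps the denominator of
    the map away from zero. *)
Lemma Cmod_1_plus_ge_half (w : C) :
  (Cmod w <= 1 / 2)%R -> (1 / 2 <= Cmod (1 + w))%R.
Proof.
  intros Hw.
  assert (H := Cmod_triangle (1 + w) (- w)).
  replace (1 + w + - w) with (RtoC 1) in H by ring.
  rewrite Cmod_1, Cmod_opp in H.
  lra.
Qed.

(** The difference is exactly [- (c z) z / (1 + c z)]; the factor [2] bounds the
    inverse of the denominator. *)
Lemma Cmod_mobius_remainder_le (c z : C) :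
  (Cmod (c * z) <= 1 / 2)%R ->
  (Cmod (z / (1 + c * z) - z) <= 2 * Cmod (c * z) * Cmod z)%R.
Proof.
  intros Hcz.
  assert (Hge := Cmod_1_plus_ge_half _ Hcz).
  assert (Hne : 1 + c * z <> 0).
  { intros H0. rewrite H0, Cmod_0 in Hge. lra. }
  replace (z / (1 + c * z) - z) with (- (c * z) * z / (1 + c * z))
    by (field; exact Hne).
  rewrite Cmod_div by exact Hne.
  rewrite Cmod_mult, Cmod_opp.
  assert (Hprod : (0 <= Cmod (c * z) * Cmod z)%R)
    by (apply Rmult_le_pos; apply Cmod_ge_0).
  apply Rle_div_l; [lra |].
  nra.
Qed.

Lemma is_derive_mobius_0 (c : C) :
  is_derive (K := C_AbsRing) (V := C_NormedModule)
    (fun z : C => z / (1 + c * z)) (RtoC 0) (RtoC 1).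
Proof.
  split.
  - apply is_linear_scal_l.
  - intros x Hx eps.
    (* The filter is [locally 0], so its only limit point [x] is [0]. *)
    apply (is_filter_lim_locally_unique
             (V := AbsRing_NormedModule C_AbsRing)) in Hx. subst x.
    assert (Heps := cond_pos eps).
    assert (Hc := Cmod_ge_0 c).
    set (m := Rmin (1 / 2) (eps / 2)).
    assert (Hm : (0 < m)%R) by (apply Rmin_pos; lra).
    assert (Hm1 : (m <= 1 / 2)%R) by apply Rmin_l.
    assert (Hm2 : (m <= eps / 2)%R) by apply Rmin_r.
    (* Dividing by [|c| + 1] rather than [|c|] allows [c = 0], and gives
       [|c z| <= m] on the ball. *)
    assert (Hr : (0 < m / (Cmod c + 1))%R) by (apply Rdiv_lt_0_compat; lra).
    exists (mkposreal _ Hr). intros z Hz. change C in z.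
    change (Cmod (z - 0) < m / (Cmod c + 1))%R in Hz.
    change (Cmod (z / (1 + c * z) - 0 / (1 + c * 0) - (z - 0) * 1)
            <= eps * Cmod (z - 0))%R.
    replace (z - 0) with z in * by ring.
    replace (z / (1 + c * z) - 0 / (1 + c * 0) - z * 1)
      with (z / (1 + c * z) - z) by (unfold Cdiv; ring).
    assert (Hz0 := Cmod_ge_0 z).
    apply Rlt_div_r in Hz; [| lra].
    assert (Hcz : (Cmod (c * z) <= m)%R) by (rewrite Cmod_mult; nra).
    eapply Rle_trans; [apply Cmod_mobius_remainder_le; lra |].
    apply Rmult_le_compat_r; lra.
Qed.

Theorem theorem3p3 (p q : C) :
  is_equilibrium (rational_map p q) (RtoC 0) /\
  non_hyperbolic (rational_map p q) (RtoC 0).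
Proof.
  split.
  - unfold is_equilibrium, rational_map, Cdiv. ring.
  - exists (RtoC 1), (RtoC 0). split; [| split].
    + unfold is_partial_0, rational_map.
      eapply (is_derive_ext (K := C_AbsRing) (V := C_NormedModule));
        [| apply (is_derive_mobius_0 p)].
      intros z. change C in z. cbv beta.
      f_equal. ring.
    + unfold is_partial_1, rational_map.
      eapply (is_derive_ext (K := C_AbsRing) (V := C_NormedModule));
        [| apply (is_derive_const (K := C_AbsRing) (V := C_NormedModule)
                    (RtoC 0))].
      intros z. change C in z. symmetry. apply Cmult_0_l.
    + exists (RtoC 1). split.
      * unfold is_characteristic_root. simpl. ring.
      * apply Cmod_1.
Qed.
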